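(* For all indices $\mathbf{k}$ and $\mathbf{l}$, \[\zeta^{s,t,*}_{\widehat{\mathcal S}}(\mathbf{k}*\mathbf{l};T_1,T_2)=\zeta^{s,t,*}_{\widehat{\mathcal S}}(\mathbf{k};T_1,T_2)\,\zeta^{s,t,*}_{\widehat{\mathcal S}}(\mathbf{l};T_1,T_2)\quad\text{in }\mathcal Z[T_1,T_2][[s,t]].\] Consequently $\zeta^{s,t}_{\widehat{\mathcal S}}(\mathbf{k}*\mathbf{l})=\zeta^{s,t}_{\widehat{\mathcal S}}(\mathbf{k})\zeta^{s,t}_{\widehat{\mathcal S}}(\mathbf{l})$ in $(\mathcal Z/\zeta(2)\mathcal Z)[[s,t]]$.
   Context: $s,t,T,T_1,T_2$ are commuting indeterminates. Index notation: an index is a finite tuple $\mathbf{k}=(k_1,\dots,k_r)$ of positive integers ($r\ge0$; the empty index is $\varnothing$). Its depth is $\mathrm{dep}(\mathbf{k})=r$ and its weight is $\mathrm{wt}(\mathbf{k})=k_1+\cdots+k_r$. For $0\le i\le r$ put $\mathbf{k}_{[i]}=(k_1,\dots,k_i)$ and $\mathbf{k}^{[i]}=(k_{i+1},\dots,k_r)$, and let $\overleftarrow{\mathbf{k}}=(k_r,\dots,k_1)$. For tuples $\mathbf{k},\mathbf{l}$ of the same length $r$, $\mathbf{k}\oplus\mathbf{l}=(k_1+l_1,\dots,k_r+l_r)$ and $b\binom{\mathbf{k}}{\mathbf{l}}=\prod_{i=1}^r\binom{k_i+l_i-1}{l_i}$. An index is admissible if it is empty or $k_r\ge2$; then $\zeta(\mathbf{k})=\sum_{0<n_1<\cdots<n_r}n_1^{-k_1}\cdots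 n_r^{-k_r}$, $\zeta(\varnothing)=1$. $\mathcal Z$ is the $\mathbb Q$-algebra generated by all these values. Every map defined on indices is extended $\mathbb Q$-linearly to formal $\mathbb Q$-linear combinations of indices. Words: $\mathfrak H=\mathbb Q\langle e_0,e_1\rangle$ (noncommutative polynomials), $\mathfrak H^1=\mathbb Q+e_1\mathfrak H$, $\mathfrak H^0=\mathbb Q+e_1\mathfrak He_0$, and $e_{\mathbf{k}}=e_1e_0^{k_1-1}\cdots e_1e_0^{k_r-1}$ ($e_\varnothing=1$). The harmonic product $*$ on $\mathfrak H^1$ is the $\mathbb Q$-bilinear product with $1*w=w*1=w$ and $we_{(k)}*w'e_{(l)}=(we_{(k)}*w')e_{(l)}+(w*w'e_{(l)})e_{(k)}-(w*w')e_{(k+l)}$ for $w,w'\in\mathfrak H^1$, $k,l\ge1$. The harmonic product of formal linear combinations of indices is transported via the linear bijection $\mathbf{k}\mapsto(-1)^{\mathrm{dep}(\mathbf{k})}e_{\mathbf{k}}$ onto $\mathfrak H^1$. Regularized values: $Z:\mathfrak H^0\to\mathbb R$ is linear with $Z(e_{\mathbf k})=(-1)^{\mathrm{dep}(\mathbf k)}\zeta(\mathbf k)$ for admissible $\mathbf k$. $Z^*_T:\mathfrak H^1\to\mathbb R[T]$ is the unique $\mathbb Q$-algebra homomorphism for $*$ extending $Z$ with $Z^*_T(e_1)=-T$, and $\zeta^*(\mathbf{k};T)=(-1)^{\mathrm{dep}(\mathbf k)}Z^*_T(e_{\mathbf k})$. The shuffle-regularized $\zeta^{ш}(\mathbf k;T)$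 is defined the same way using the shuffle product. Shifted values: $\zeta^{t,\bullet}_{\mathrm{shift}}(\mathbf{k};T)=\sum_{\mathbf n\in\mathbb Z_{\ge0}^{\mathrm{dep}(\mathbf k)}}b\binom{\mathbf k}{\mathbf n}\zeta^{\bullet}(\mathbf k\oplus\mathbf n;T)(-t)^{\mathrm{wt}(\mathbf n)}$, and similarly with $t$ replaced by $s$ or by $-t$. $(s,t)$-adic SMZVs: for an index $\mathbf k$ of depth $r$ and $\bullet\in\{*,ш\}$, $\zeta^{s,t,\bullet}_{\widehat{\mathcal S}}(\mathbf k;T_1,T_2)=\sum_{i=0}^{r}(-1)^{\mathrm{wt}(\mathbf k^{[i]})}\zeta^{s,\bullet}_{\mathrm{shift}}(\mathbf k_{[i]};T_1)\,\zeta^{-t,\bullet}_{\mathrm{shift}}(\overleftarrow{\mathbf k^{[i]}};T_2)\in\mathcal Z[T_1,T_2][[s,t]]$. $\zeta^{s,t}_{\widehat{\mathcal S}}(\mathbf k)$ is the image of $\zeta^{s,t,\bullet}_{\widehat{\mathcal S}}(\mathbf k;T,T)$ in $(\mathcal Z/\zeta(2)\mathcal Z)[[s,t]]$; it is independent of $T$ and of $\bullet$. *)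

(* Defs.v *)
From HB Require Import structures.
From mathcomp Require Import all_boot all_order all_algebra.
From mathcomp Require Import all_classical all_reals all_analysis.
Set Implicit Arguments. Unset Strict Implicit. Unset Printing Implicit Defensive.
Import Order.TTheory GRing.Theory Num.Theory.
Import numFieldNormedType.Exports.
Local Open Scope ring_scope.

Section MZV.
Variable R : realType.

Definition is_index (k : seq nat) : bool := all (fun x => (0 < x)%N) k.
Definition admissible (k : seq nat) : bool := is_index k && (2 <= last 2 k)%N.

(** Partial sums  sum_{0<n_1<...<n_r<N} n_1^{-k_1} ... n_r^{-k_r},
    defined on the reversed index (recursion on the last entry). *)
Fixpoint msum_rev (kr : seq nat) (N : nat) : R :=
  match kr with
  | [::] => 1
  | a :: kr' => \sum_(1 <= m < N) msum_rev kr' m / (m%:R ^+ a)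
  end.
Definition msum (k : seq nat) (N : nat) : R := msum_rev (rev k) N.

Definition mzv (k : seq nat) : R := limn (msum k).

Inductive inMZ : R -> Prop :=
| inMZ_zeta k : admissible k -> inMZ (mzv k)
| inMZ_rat (q : rat) : inMZ (ratr q)
| inMZ_add x y : inMZ x -> inMZ y -> inMZ (x + y)
| inMZ_mul x y : inMZ x -> inMZ y -> inMZ (x * y).
Definition in_zeta2_MZ (x : R) : Prop := exists z, inMZ z /\ x = mzv [:: 2%N] * z.

End MZV.

(** Formal Q-linear combinations of indices, as lists of (coefficient, index). *)
Definition comb := seq (rat * seq nat).
Definition comb_map (f : seq nat -> seq nat) (c : comb) : comb :=
  [seq (p.1, f p.2) | p <- c].
Definition comb_opp (c : comb) : comb := [seq (- p.1, p.2) | p <- c].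

(** Harmonic product of words of H^1, written in the basis e_k (k an index);
    computed on REVERSED indices so that the recursion peels off the last
    letters:  w e_(a) * w' e_(b) = (w e_(a) * w') e_(b) + (w * w' e_(b)) e_(a)
                                   - (w * w') e_(a+b). *)
Fixpoint hprod_rev (u : seq nat) : seq nat -> comb :=
  fix hprod_u (v : seq nat) : comb :=
  match u, v with
  | [::], _ => [:: (1%R, v)]
  | _, [::] => [:: (1%R, u)]
  | a :: u', b :: v' =>
      comb_map (cons b) (hprod_u v')
      ++ comb_map (cons a) (hprod_rev u' v)
      ++ comb_opp (comb_map (cons (a + b)%N) (hprod_rev u' v'))
  end.

Definition hprod_word (k l : seq nat) : comb :=
  comb_map (@rev nat) (hprod_rev (rev k) (rev l)).

(** Harmonic product of indices, transported via  k |-> (-1)^dep(k) e_k . *)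
Definition hprod_index (k l : seq nat) : comb :=
  [seq ((-1) ^+ (size k + size l + size p.2) * p.1, p.2) | p <- hprod_word k l].

Definition lin_ext (V : unitRingType) (f : seq nat -> V) (c : comb) : V :=
  \sum_(p <- c) ratr p.1 * f p.2.

Section Regularized.
Variable R : realType.

(** Z^*_T, given by its values Zs k = Z^*_T(e_k) on the basis words e_k.
    [is_Zstar Zs] says that (the linear extension of) Zs is a Q-algebra
    homomorphism (H^1, * ) -> R[T] extending Z on H^0, with Z^*_T(e_1) = -T.
    Such a map exists and is unique. *)
Definition is_Zstar (Zs : seq nat -> {poly R}) : Prop :=
  [/\ Zs [::] = 1,
      Zs [:: 1%N] = - 'X,
      (forall k, admissible k -> Zs k = ((-1) ^+ size k * mzv R k)%:P) &
      (forall k l, is_index k -> is_index l ->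
         lin_ext Zs (hprod_word k l) = Zs k * Zs l)].

Variable Zs : seq nat -> {poly R}.

Definition zeta_star (k : seq nat) : {poly R} := (-1) ^+ size k * Zs k.

Definition idx_add (k n : seq nat) : seq nat := [seq p.1 + p.2 | p <- zip k n]%N.
Definition bweight (k n : seq nat) : nat :=
  \prod_(p <- zip k n) 'C(p.1 + p.2 - 1, p.2).

(** Coefficient of x^j in  sum_n b(k;n) zeta^*(k(+)n;T) (sg x)^{wt n}:
    sg = -1 gives zeta^{x,*}_shift, sg = 1 gives zeta^{-x,*}_shift. *)
Definition shift_coef (sg : R) (k : seq nat) (j : nat) : {poly R} :=
  \sum_(n : (size k).-tuple 'I_j.+1 | sumn (map val n) == j)
     (bweight k (map val n))%:R *: zeta_star (idx_add k (map val n)) * (sg ^+ j)%:P.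

(** Coefficient of s^a t^b of zeta^{s,t,*}_S(k;T1,T2) in Z[T1,T2] =
    R[T1][T2] = {poly {poly R}} : T1 is the inner variable, T2 the outer. *)
Definition zetaS_coef (k : seq nat) (a b : nat) : {poly {poly R}} :=
  \sum_(i < (size k).+1)
     ((-1) ^+ sumn (drop i k))%:P%:P
     * (shift_coef (-1) (take i k) a)%:P
     * map_poly polyC (shift_coef 1 (rev (drop i k)) b).

Definition zetaS_coef_TT (k : seq nat) (a b : nat) : {poly R} :=
  (zetaS_coef k a b).[ 'X ].

End Regularized.

Definition ps_mul (V : pzRingType) (F G : nat -> nat -> V) (a b : nat) : V :=
  \sum_(a1 < a.+1) \sum_(b1 < b.+1) F a1 b1 * G (a - a1)%N (b - b1)%N.

(* Main.v *)
(** Up to the signs [(-1)^dep] the harmonic product is the stuffle product with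
    all coefficients [1], so the claim is that [zetaS_coef] is a character of the
    stuffle algebra with values in power series.  Three facts give this:
    - [z_a |-> sum_n C(a+n-1,n) x^n z_{a+n}] (the expansion of [(m-x)^(-a)])
      respects [z_a, z_b |-> z_{a+b}] by the negative binomial Vandermonde
      identity, so the shifted values of a character form a character;
    - reversal and the sign [(-1)^wt] preserve characters;
    - deconcatenation is multiplicative for the stuffle product, so the
      convolution of two characters is a character.
    Evaluating at [T1 = T2] then gives an equality that holds even before
    reducing modulo [zeta(2)]. *)
Require Import Defs.
From HB Require Import structures.
From mathcomp Require Import all_boot all_order all_algebra.
From mathcomp Require Import all_classical all_reals all_analysis.
From mathcomp Require Import ring.
Import Order.TTheory GRing.Theory Num.Theory.
Local Open Scope ring_scope.

(** * Stuffle product *)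

(** The list keeps multiplicities, and its three blocks come in the order used by [hprod_rev], so
    that the two products can be compared entry by entry. *)
Fixpoint stuffle (u : seq nat) : seq nat -> seq (seq nat) :=
  fix stuffle_u (v : seq nat) : seq (seq nat) :=
  match u, v with
  | [::], _ => [:: v]
  | _, [::] => [:: u]
  | a :: u', b :: v' =>
      map (cons b) (stuffle_u v')
      ++ map (cons a) (stuffle u' v)
      ++ map (cons (a + b)%N) (stuffle u' v')
  end.

Lemma stuffle0s v : stuffle [::] v = [:: v].
Proof. by case: v. Qed.

Lemma stuffles0 u : stuffle u [::] = [:: u].
Proof. by case: u. Qed.

Lemma stuffle_cons a u b v :
  stuffle (a :: u) (b :: v) =
  map (cons b) (stuffle (a :: u) v)
  ++ map (cons a) (stuffle u (b :: v))
  ++ map (cons (a + b)%N) (stuffle u v).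
Proof. by []. Qed.

(** Each contraction [a + b] costs one unit of depth and one sign, so the sign of a term is the
    parity of the depth lost. *)
Lemma hprod_rev_stuffle u v :
  hprod_rev u v =
  [seq ((-1) ^+ (size u + size v + size m), m) | m <- stuffle u v].
Proof.
elim: u v => [|a u IHu] v.
  by case: v => [|b v] //=; rewrite add0n addnn -signr_odd odd_double.
elim: v => [|b v IHv]; first by rewrite /= addn0 addnn -signr_odd odd_double.
rewrite -[LHS]/(comb_map (cons b) (hprod_rev (a :: u) v)
  ++ comb_map (cons a) (hprod_rev u (b :: v))
  ++ comb_opp (comb_map (cons (a + b)%N) (hprod_rev u v))).
rewrite IHv !IHu stuffle_cons /comb_map /comb_opp !map_cat -!map_comp.
congr (_ ++ (_ ++ _)); apply: eq_map => m /=; congr pair;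
  by rewrite ?addnS ?addSn ?addnS !exprS; ring.
Qed.

Lemma hprod_index_stuffle k l :
  hprod_index k l = [seq (1, rev m) | m <- stuffle (rev k) (rev l)].
Proof.
rewrite /hprod_index /hprod_word hprod_rev_stuffle /comb_map -!map_comp.
apply: eq_map => m /=.
by rewrite !size_rev -exprD addnn -signr_odd odd_double.
Qed.

Lemma stuffle_sumn u v m : m \in stuffle u v -> sumn m = (sumn u + sumn v)%N.
Proof.
elim: u v m => [|a u IHu] v m.
  by rewrite stuffle0s inE => /eqP ->.
elim: v m => [|b v IHv] m.
  by rewrite stuffles0 inE => /eqP ->; rewrite addn0.
rewrite stuffle_cons !mem_cat.
case/or3P => /mapP[m' hm' ->] /=.
- by rewrite (IHv _ hm') /= addnCA.
- by rewrite (IHu _ _ hm') /= addnA.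
- by rewrite (IHu _ _ hm') addnACA.
Qed.

Section StuffleSum.
Variable V : comNzRingType.
Implicit Types (F : seq nat -> V) (u v : seq nat).

(** With [F] as an argument, the recursion can absorb into it the letters already placed. *)
Definition stuffle_sum u v F : V := \sum_(m <- stuffle u v) F m.

Lemma stuffle_sum0s v F : stuffle_sum [::] v F = F v.
Proof. by rewrite /stuffle_sum stuffle0s big_seq1. Qed.

Lemma stuffle_sums0 u F : stuffle_sum u [::] F = F u.
Proof. by rewrite /stuffle_sum stuffles0 big_seq1. Qed.

Lemma stuffle_sum_cons a u b v F :
  stuffle_sum (a :: u) (b :: v) F =
  stuffle_sum (a :: u) v (fun m => F (b :: m))
  + stuffle_sum u (b :: v) (fun m => F (a :: m))
  + stuffle_sum u v (fun m => F ((a + b)%N :: m)).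
Proof. by rewrite /stuffle_sum stuffle_cons !big_cat !big_map /= addrA. Qed.

(** Expanding at the first letters and at the last letters commute, so the recursion carries over to
    the right-hand end; reversal invariance follows. *)
Lemma stuffle_sum_rcons a u b v F :
  stuffle_sum (rcons u a) (rcons v b) F =
  stuffle_sum (rcons u a) v (fun m => F (rcons m b))
  + stuffle_sum u (rcons v b) (fun m => F (rcons m a))
  + stuffle_sum u v (fun m => F (rcons m (a + b)%N)).
Proof.
elim: u v F => [|c u IHu].
  elim=> [|d v IHv] F /=;
    rewrite !stuffle_sum_cons ?IHv !(stuffle_sums0, stuffle_sum0s) /=; ring.
elim=> [|d v IHv] F.
  rewrite !rcons_cons [rcons [::] b]/= !stuffle_sum_cons.
  rewrite (IHu [::]) !stuffle_sums0 /=; ring.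
rewrite !rcons_cons !stuffle_sum_cons -!rcons_cons IHv !IHu /=; ring.
Qed.

Lemma stuffle_sum_rev u v F :
  stuffle_sum (rev u) (rev v) (fun m => F (rev m)) = stuffle_sum u v F.
Proof.
elim: u v F => [|a u IHu] v F.
  by rewrite !stuffle_sum0s revK.
elim: v F => [|b v IHv] F; first by rewrite !stuffle_sums0 revK.
rewrite !rev_cons stuffle_sum_rcons -rev_cons -(rev_cons b).
rewrite stuffle_sum_cons -IHv -!IHu; congr (_ + _ + _);
  by apply: eq_bigr => m _; rewrite rev_rcons.
Qed.

Lemma eq_stuffle_sum u v F G :
  (forall m, F m = G m) -> stuffle_sum u v F = stuffle_sum u v G.
Proof. by move=> FG; apply: eq_bigr => m _. Qed.

Lemma stuffle_sum_sum (I : Type) (r : seq I) u v (F : I -> seq nat -> V) :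
  stuffle_sum u v (fun m => \sum_(i <- r) F i m)
  = \sum_(i <- r) stuffle_sum u v (F i).
Proof. exact: exchange_big. Qed.

End StuffleSum.

Arguments stuffle_sum {V}.
Arguments stuffle_sum_sum {V I}.

(** * Deconcatenation *)

Section Deconcatenation.
Variable V : comNzRingType.
Implicit Types (F : seq nat -> seq nat -> V).

Definition deconc F (m : seq nat) : V :=
  \sum_(i < (size m).+1) F (take i m) (drop i m).

Lemma deconc_nil F : deconc F [::] = F [::] [::].
Proof. by rewrite /deconc big_ord1. Qed.

Lemma deconc_cons F a m :
  deconc F (a :: m) = F [::] (a :: m) + deconc (fun x y => F (a :: x) y) m.
Proof. by rewrite /deconc big_ord_recl. Qed.

Lemma eq_deconc F G m : (forall x y, F x y = G x y) -> deconc F m = deconc G m.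
Proof. by move=> FG; apply: eq_bigr => i _. Qed.

Lemma deconcD F G m :
  deconc (fun x y => F x y + G x y) m = deconc F m + deconc G m.
Proof. exact: big_split. Qed.

(** Induction on both words: a cut either precedes the first letter of a word or leaves that letter
    in the left part, where the stuffle recursion applies. *)
Lemma stuffle_deconc F u v :
  stuffle_sum u v (deconc F) =
  deconc (fun x x' => deconc (fun y y' => stuffle_sum x y (fun z =>
    stuffle_sum x' y' (F z))) v) u.
Proof.
elim: u v F => [|a u IHu] v F.
  rewrite stuffle_sum0s deconc_nil.
  by apply: eq_deconc => x y; rewrite !stuffle_sum0s.
elim: v F => [|b v IHv] F.
  rewrite stuffle_sums0; apply: eq_deconc => x y.
  by rewrite deconc_nil !stuffle_sums0.
(* In each branch the cut before the first letter is split off; these terms recombine into the sum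
   with empty left part. *)
have -> : stuffle_sum (a :: u) (b :: v) (deconc F) =
    stuffle_sum (a :: u) (b :: v) (F [::])
    + (stuffle_sum (a :: u) v (deconc (fun x => F (b :: x)))
    + stuffle_sum u (b :: v) (deconc (fun x => F (a :: x)))
    + stuffle_sum u v (deconc (fun x => F ((a + b)%N :: x)))).
  rewrite !stuffle_sum_cons /stuffle_sum.
  do 3 (rewrite (eq_bigr _ (fun i _ => deconc_cons F _ i)) big_split /=).
  ring.
pose D2 w w' G := deconc (fun x x' => deconc (fun y y' => G x x' y y') w') w.
have D2_consl w w' G : D2 (a :: w) w' G =
    deconc (G [::] (a :: w)) w' + D2 w w' (fun x => G (a :: x)).
  by rewrite /D2 deconc_cons.
have D2_consr w w' G : D2 w (b :: w') G =
    deconc (fun x x' => G x x' [::] (b :: w')) w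
    + D2 w w' (fun x x' y => G x x' (b :: y)).
  by rewrite /D2 -deconcD; apply: eq_deconc => x x'; rewrite deconc_cons.
pose T x x' y y' := stuffle_sum x y (fun z => stuffle_sum x' y' (F z)).
(* All three branches of the stuffle recursion occur only where both left parts are nonempty. *)
have D2T : D2 u v (fun x x' y => T (a :: x) x' (b :: y)) =
    D2 u v (fun x x' y y' => stuffle_sum (a :: x) y
              (fun z => stuffle_sum x' y' (F (b :: z))))
    + D2 u v (fun x x' y y' => stuffle_sum x (b :: y)
              (fun z => stuffle_sum x' y' (F (a :: z))))
    + D2 u v (fun x x' y y' => stuffle_sum x y
              (fun z => stuffle_sum x' y' (F ((a + b)%N :: z)))).
  rewrite /D2 -!deconcD; apply: eq_deconc => x x'.
  by rewrite -!deconcD; apply: eq_deconc => y y'; apply: stuffle_sum_cons.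
rewrite IHv !IHu -![deconc (fun x x' => deconc _ _) _]/(D2 _ _ _).
rewrite -/(D2 (a :: u) (b :: v) T) !D2_consl !D2_consr D2T deconc_cons.
rewrite /T !stuffle_sum0s.
under [in RHS]eq_deconc do rewrite stuffle_sum0s.
under [in LHS]eq_deconc do rewrite stuffle_sum0s.
under [X in _ + (X + _) + _]eq_deconc do rewrite stuffle_sums0.
under [X in _ = _ + (X + _)]eq_deconc do rewrite stuffle_sums0.
ring.
Qed.

End Deconcatenation.

(** * Shifted characters *)

(** The coefficient of [x^n] in [(1 - x)^(-a)]; truncated subtraction gives the right value 1 at
    [a = n = 0]. *)
Definition negbin (a n : nat) : nat := 'C(a + n - 1, n).

Lemma negbin0 n : negbin 0 n = (n == 0%N).
Proof. by case: n => // n; rewrite /negbin add0n subn1 bin_small. Qed.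

Lemma negbin_n0 a : negbin a 0 = 1%N.
Proof. exact: bin0. Qed.

Lemma negbinS a n : negbin a.+1 n.+1 = (negbin a.+1 n + negbin a n.+1)%N.
Proof. by rewrite /negbin !addSn !addnS !subn1 /= binS addnC. Qed.

(** Coefficients of [(1 - x)^(-a) (1 - x)^(-b) = (1 - x)^(-(a + b))]; both inductions rest on
    Pascal's rule [negbinS]. *)
Lemma negbin_Vandermonde a b n :
  (\sum_(i < n.+1) negbin a i * negbin b (n - i) = negbin (a + b) n)%N.
Proof.
elim: a n => [|a IHa] n.
  rewrite big_ord_recl negbin0 mul1n subn0 big1 ?addn0 // => i _.
  by rewrite negbin0.
elim: n => [|n IHn]; first by rewrite big_ord1 !negbin_n0.
rewrite addSn negbinS -addSn -IHn -IHa.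
rewrite [LHS]big_ord_recl [X in _ = (_ + X)%N]big_ord_recl /= !negbin_n0.
rewrite addnCA -big_split /=; congr addn; apply: eq_bigr => i _.
by rewrite negbinS mulnDl.
Qed.

(** * Power series truncated modulo [X^N] *)

Section Shift.
Variable V : comNzRingType.
Implicit Types (P Q : {poly V}) (F : seq nat -> {poly V}) (u v : seq nat).

Definition eqmodX N P Q := forall j, (j < N)%N -> P`_j = Q`_j.

Lemma eqmodX_trans N P Q S : eqmodX N P Q -> eqmodX N Q S -> eqmodX N P S.
Proof. by move=> PQ QS j jN; rewrite PQ ?QS. Qed.

Lemma eqmodX_sym N P Q : eqmodX N P Q -> eqmodX N Q P.
Proof. by move=> PQ j jN; rewrite PQ. Qed.

Lemma eqmodXD N P P' Q Q' :
  eqmodX N P P' -> eqmodX N Q Q' -> eqmodX N (P + Q) (P' + Q').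
Proof. by move=> PP QQ j jN; rewrite !coefD PP ?QQ. Qed.

Lemma eqmodX_sum N (I : Type) (r : seq I) (C : pred I) (P Q : I -> {poly V}) :
  (forall i, C i -> eqmodX N (P i) (Q i)) ->
  eqmodX N (\sum_(i <- r | C i) P i) (\sum_(i <- r | C i) Q i).
Proof. by move=> PQ j jN; rewrite !coef_sum; apply: eq_bigr => i /PQ ->. Qed.

Lemma eqmodX_mull N S P Q : eqmodX N P Q -> eqmodX N (S * P) (S * Q).
Proof.
move=> PQ j jN; rewrite !coefM; apply: eq_bigr => i _.
by rewrite PQ // (leq_ltn_trans (leq_subr _ _)).
Qed.

Definition shift_mono (a n : nat) : {poly V} := (negbin a n)%:R * 'X^n.

(** The pairs with [n + p < N], grouped by [n + p], are summed by the Vandermonde identity; the rest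
    of the square is divisible by [X^N]. *)
Lemma shift_mono_conv N a b (G : nat -> {poly V}) :
  eqmodX N
    (\sum_(n < N) shift_mono a n * \sum_(p < N) shift_mono b p * G (n + p)%N)
    (\sum_(n < N) shift_mono (a + b) n * G n).
Proof.
pose H i n := shift_mono a i * shift_mono b n * G (i + n)%N.
have -> : \sum_(n < N) shift_mono (a + b) n * G n =
    \sum_(i < N) \sum_(0 <= n < N - i) H i n.
  rewrite -(big_mkord xpredT (fun n => shift_mono (a + b) n * G n)).
  rewrite -(big_mkord xpredT (fun i => \sum_(0 <= n < N - i) H i n)).
  transitivity (\sum_(0 <= n < N) \sum_(0 <= i < N | (i <= n)%N) H i (n - i)%N).
    rewrite big_nat [RHS]big_nat; apply: eq_bigr => n /andP[_ nN].
    transitivity (\sum_(0 <= i < n.+1) H i (n - i)%N).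
      rewrite big_mkord /shift_mono -negbin_Vandermonde natr_sum !mulr_suml.
      apply: eq_bigr => i _; rewrite /H /shift_mono subnKC -1?ltnS //.
      rewrite natrM -[in 'X^n](@subnKC i n) -1?ltnS // exprD; ring.
    rewrite (big_nat_widen _ _ N) //=; apply: eq_bigl.
  rewrite (exchange_big_dep_nat xpredT) //=.
  rewrite big_nat [RHS]big_nat; apply: eq_bigr => i /andP[_ iN].
  rewrite -(big_nat_widenl i 0 N xpredT) // -{1}(add0n i) big_addn.
  by apply: eq_bigr => n _; rewrite addnK.
apply: eqmodX_sum => n _; rewrite mulr_sumr.
rewrite -(big_mkord xpredT (fun p =>
  shift_mono a n * (shift_mono b p * G (n + p)%N))).
(* Cut at [N - n]: the lower range is the triangle, the upper one vanishes modulo [X^N]. *)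
rewrite (big_cat_nat (leq0n _) (leq_subr n N)) /=.
rewrite -[X in eqmodX _ _ X]addr0; apply: eqmodXD.
  by apply: eqmodX_sum => p _ j jN; rewrite /H mulrA.
move=> j jN; rewrite coef0 coef_sum big_nat big1 // => p /andP[Np _].
have -> : shift_mono a n * (shift_mono b p * G (n + p)%N) =
    'X^(n + p) * ((negbin a n)%:R * (negbin b p)%:R * G (n + p)%N).
  by rewrite /shift_mono exprD; ring.
by rewrite coefXnM (leq_trans jN) // -leq_subLR.
Qed.

(** Truncating every inner sum at [N] keeps all sums rectangular; the result is
    only meaningful modulo ['X^N]. *)
Fixpoint shift_sum N F u : {poly V} :=
  if u is a :: u' then
    \sum_(n < N) shift_mono a n * shift_sum N (fun x => F ((a + n)%N :: x)) u'
  else F [::].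

Lemma shift_sum_lin N (I : Type) (r : seq I) (c : I -> {poly V})
    (G : I -> seq nat -> {poly V}) u :
  shift_sum N (fun x => \sum_(i <- r) c i * G i x) u
  = \sum_(i <- r) c i * shift_sum N (G i) u.
Proof.
elim: u G => [|a u IHu] G //=.
under eq_bigr do rewrite IHu mulr_sumr.
rewrite exchange_big; apply: eq_bigr => i _; rewrite mulr_sumr.
by apply: eq_bigr => n _; rewrite mulrCA.
Qed.

Lemma shift_sumD N F G u :
  shift_sum N (fun x => F x + G x) u = shift_sum N F u + shift_sum N G u.
Proof.
elim: u F G => [|a u IHu] F G //=; rewrite -big_split.
by apply: eq_bigr => n _; rewrite IHu mulrDr.
Qed.

Lemma shift_sumZ N c F u :
  shift_sum N (fun x => c * F x) u = c * shift_sum N F u.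
Proof.
have := @shift_sum_lin N unit [:: tt] (fun=> c) (fun=> F) u.
rewrite big_seq1 => <-; congr shift_sum; apply/funext => x.
by rewrite big_seq1.
Qed.

(** Shifts keep entries positive. This matters because the character property is known on indices
    only. *)
Lemma eq_shift_sum_index N F G u : is_index u ->
  (forall x, is_index x -> F x = G x) -> shift_sum N F u = shift_sum N G u.
Proof.
elim: u F G => [|a u IHu] F G /=; first by move=> _; apply.
case/andP=> a0 hu FG; apply: eq_bigr => n _; congr (_ * _).
by apply: IHu => // x hx; apply: FG; rewrite /= addn_gt0 a0.
Qed.

(** A term with some shift at least [N] is a multiple of [X^N]. *)
Lemma shift_sum_widen N M F u : (N <= M)%N ->
  eqmodX N (shift_sum M F u) (shift_sum N F u).
Proof.
move=> NM; elim: u F => [|a u IHu] F //=.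
rewrite -!(big_mkord xpredT (fun n => shift_mono a n *
  shift_sum _ (fun x => F ((a + n)%N :: x)) u)).
rewrite (big_cat_nat (leq0n N) NM) //= -[X in eqmodX _ _ X]addr0; apply: eqmodXD.
  by apply: eqmodX_sum => n _; apply: eqmodX_mull.
move=> j jN; rewrite coef0 coef_sum big_nat big1 // => n /andP[Nn _].
by rewrite /shift_mono -mulrA mulrCA coefXnM (leq_trans jN).
Qed.

(** The shift respects the stuffle product: two branches of the recursion follow by induction, and
    the contracted one also needs [shift_mono_conv]. *)
Lemma stuffle_shift_sum N F u v :
  eqmodX N (stuffle_sum u v (shift_sum N F))
    (shift_sum N (fun x => shift_sum N (fun y => stuffle_sum x y F) v) u).
Proof.
elim: u v F => [|a u IHu] v F.
  rewrite stuffle_sum0s /=.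
  by under [X in eqmodX _ _ (shift_sum _ X _)]eq_fun do rewrite stuffle_sum0s.
elim: v F => [|b v IHv] F.
  rewrite stuffle_sums0; move: (a :: u) => w /=.
  by under [X in eqmodX _ _ (shift_sum _ X _)]eq_fun do rewrite stuffle_sums0.
rewrite stuffle_sum_cons /=.
(* [E] sums over the shifts of the tails once the first letters are shifted by [n] and [p]; [G1],
   [G2], [G3] are the three branches. *)
pose E (n p : nat) (G : nat -> nat -> seq nat -> seq nat -> {poly V}) :=
  shift_sum N (fun x => shift_sum N (fun y => G n p x y) v) u.
pose G1 n p x y := stuffle_sum ((a + n)%N :: x) y (fun m => F ((b + p)%N :: m)).
pose G2 n p x y := stuffle_sum x ((b + p)%N :: y) (fun m => F ((a + n)%N :: m)).
(* The contracted letter [(a + n) + (b + p)] is regrouped so that the shifts enter only through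
   [n + p]. *)
pose G3 n p x y := stuffle_sum x y (fun m => F ((a + b + (n + p))%N :: m)).
pose W G := \sum_(n < N) shift_mono a n * \sum_(p < N) shift_mono b p * E n p G.
have -> : \sum_(n < N) shift_mono a n * shift_sum N (fun x =>
    \sum_(p < N) shift_mono b p * shift_sum N (fun y =>
      stuffle_sum ((a + n)%N :: x) ((b + p)%N :: y) F) v) u
    = W G1 + W G2 + W G3.
  rewrite /W -!big_split; apply: eq_bigr => n _ /=.
  rewrite -!mulrDr -!big_split shift_sum_lin; congr (_ * _).
  apply: eq_bigr => p _ /=; rewrite -!mulrDr -!shift_sumD; congr (_ * _).
  congr shift_sum; apply/funext => x; rewrite -!shift_sumD.
  congr shift_sum; apply/funext => y.
  by rewrite stuffle_sum_cons addnACA.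
have sum_lin w w' c (H : 'I_N -> seq nat -> {poly V}) :
    stuffle_sum w w' (fun m => \sum_(n < N) c n * H n m)
    = \sum_(n < N) c n * stuffle_sum w w' (H n).
  rewrite stuffle_sum_sum; apply: eq_bigr => n _.
  by rewrite /stuffle_sum mulr_sumr.
apply: eqmodXD; first apply: eqmodXD; rewrite sum_lin.
(* The shift of [b] goes outermost; the sum over [n] then belongs to the shift of [a :: u], as in
   [IHv]. *)
- have -> : W G1 = \sum_(p < N) shift_mono b p *
      \sum_(n < N) shift_mono a n * E n p G1.
    rewrite /W; under eq_bigr do rewrite mulr_sumr.
    rewrite exchange_big; apply: eq_bigr => p _; rewrite mulr_sumr.
    by apply: eq_bigr => n _; rewrite mulrCA.
  by apply: eqmodX_sum => p _; apply: eqmodX_mull; apply: IHv.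
- apply: eqmodX_sum => n _; apply: eqmodX_mull.
  rewrite -shift_sum_lin; exact: IHu.
- apply: (eqmodX_trans _ _ _ _ _
    (eqmodX_sym _ _ _ (shift_mono_conv N a b (fun q => shift_sum N (fun x =>
      shift_sum N (fun y => stuffle_sum x y (fun m => F ((a + b + q)%N :: m)))
        v) u)))).
  by apply: eqmodX_sum => n _; apply: eqmodX_mull; apply: IHu.
Qed.

(** * Coefficients of the shifted values *)

Definition shifted (f : seq nat -> V) u (j : nat) : V :=
  (shift_sum j.+1 (fun x => (f x)%:P) u)`_j.

Lemma shift_sum_coef N f u j : (j < N)%N ->
  (shift_sum N (fun x => (f x)%:P) u)`_j = shifted f u j.
Proof. by move=> jN; rewrite (shift_sum_widen j.+1 N). Qed.

Definition is_character (f : seq nat -> V) :=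
  forall u v, is_index u -> is_index v -> stuffle_sum u v f = f u * f v.

(** Here [f u] is read as the power series with coefficients [f u j], multiplied by the Cauchy
    product. *)
Definition is_ps_character (f : seq nat -> nat -> V) :=
  forall u v j, is_index u -> is_index v ->
  stuffle_sum u v (f^~ j) = \sum_(i < j.+1) f u i * f v (j - i)%N.

Lemma shifted_character f : is_character f -> is_ps_character (shifted f).
Proof.
move=> hf u v j hu hv.
transitivity (stuffle_sum u v (shift_sum j.+1 (fun x => (f x)%:P)))`_j.
  by rewrite /stuffle_sum coef_sum.
rewrite stuffle_shift_sum //.
(* The character property turns the inner stuffle sum into [f x * f y], so the double sum
   factors. *)
rewrite (@eq_shift_sum_index _ _ (fun x =>
  shift_sum j.+1 (fun x => (f x)%:P) v * (f x)%:P)) //; last first.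
  move=> x hx; rewrite (@eq_shift_sum_index _ _ (fun y => (f x)%:P * (f y)%:P)) //.
    by rewrite shift_sumZ mulrC.
  move=> y hy; rewrite -polyCM -hf // /stuffle_sum.
  by rewrite (big_morph _ (@polyCD V) (@polyC0 V)).
rewrite shift_sumZ mulrC coefM; apply: eq_bigr => i _.
by rewrite !shift_sum_coef // ltnS leq_subr.
Qed.

(** Flattens the nested sums into the sum over tuples that appears in [shift_coef]. *)
Lemma shift_sum_tuple N F u :
  shift_sum N F u = \sum_(n : (size u).-tuple 'I_N)
    (bweight u (map val n))%:R * 'X^(sumn (map val n))
    * F (idx_add u (map val n)).
Proof.
elim: u F => [|a u IHu] F /=.
  rewrite (big_pred1 [tuple]) => [|t]; last exact/esym/eqP/tuple0.
  by rewrite /bweight big_nil mul1r mul1r.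
under eq_bigr do rewrite IHu mulr_sumr.
rewrite pair_big /=.
rewrite (reindex (fun t : (size u).+1.-tuple 'I_N =>
  (thead t, [tuple of behead t]))) /=; last first.
  exists (fun p : 'I_N * (size u).-tuple 'I_N => [tuple of p.1 :: p.2]) => [t _|[x t] _] /=.
    by rewrite [RHS]tuple_eta.
  by congr pair; apply: val_inj.
apply: eq_bigr => t _; rewrite (tuple_eta t) /= theadE.
rewrite /bweight big_cons /idx_add /= /shift_mono natrM exprD /negbin; ring.
Qed.

Lemma shifted_tuple f u j :
  shifted f u j = \sum_(n : (size u).-tuple 'I_j.+1 | sumn (map val n) == j)
    (bweight u (map val n))%:R * f (idx_add u (map val n)).
Proof.
rewrite /shifted shift_sum_tuple coef_sum [RHS]big_mkcond /=.
apply: eq_bigr => n _; rewrite -mulrA mulr_natl coefMn coefXnM coefC.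
rewrite mulr_natl.
case: (ltngtP (sumn (map val n)) j) => [lt|lt|->].
- by rewrite subn_eq0 leqNgt lt /= mul0rn.
- by rewrite mul0rn.
- by rewrite subnn.
Qed.

End Shift.

Arguments is_character {V}.
Arguments is_ps_character {V}.
Arguments shifted {V}.

(** * Operations on power-series characters *)

Lemma ps_character_rmorph (V W : comNzRingType) (g : {rmorphism V -> W}) f :
  is_ps_character f -> is_ps_character (fun u j => g (f u j)).
Proof.
move=> hf u v j hu hv; rewrite /stuffle_sum -rmorph_sum.
rewrite -[X in g X]/(stuffle_sum u v (f^~ j)) hf // rmorph_sum.
by apply: eq_bigr => i _; rewrite rmorphM.
Qed.

Lemma ps_character_rev (V : comNzRingType) (f : seq nat -> nat -> V) :
  is_ps_character f -> is_ps_character (fun u j => f (rev u) j).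
Proof.
move=> hf u v j hu hv.
have := stuffle_sum_rev V (rev u) (rev v) (f^~ j); rewrite !revK => ->.
by rewrite hf // /is_index all_rev.
Qed.

(** Weight is additive under the stuffle product, so [c ^+ sumn m] is the same for all terms [m]. *)
Lemma ps_character_twist (V : comNzRingType) (c : V) f :
  is_ps_character f -> is_ps_character (fun u j => c ^+ sumn u * f u j).
Proof.
move=> hf u v j hu hv.
transitivity (c ^+ (sumn u + sumn v) * stuffle_sum u v (f^~ j)).
  rewrite /stuffle_sum mulr_sumr big_seq [RHS]big_seq.
  by apply: eq_bigr => m /stuffle_sumn ->.
rewrite hf // mulr_sumr; apply: eq_bigr => i _; rewrite exprD; ring.
Qed.

Lemma is_index_take i u : is_index u -> is_index (take i u).
Proof. by rewrite /is_index -{1}(cat_take_drop i u) all_cat => /andP[]. Qed.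

Lemma is_index_drop i u : is_index u -> is_index (drop i u).
Proof. by rewrite /is_index -{1}(cat_take_drop i u) all_cat => /andP[]. Qed.

Lemma stuffle_deconc_ps_mul (V : comNzRingType) (f g : seq nat -> nat -> V)
    u v a b :
  is_ps_character f -> is_ps_character g -> is_index u -> is_index v ->
  let h w a b := deconc V (fun x y => f x a * g y b) w in
  stuffle_sum u v (fun m => h m a b) = ps_mul (h u) (h v) a b.
Proof.
move=> hf hg hu hv h; rewrite /h stuffle_deconc /ps_mul /deconc.
transitivity (\sum_(i < (size u).+1) \sum_(j < (size v).+1)
  (\sum_(a1 < a.+1) \sum_(b1 < b.+1)
     (f (take i u) a1 * g (drop i u) b1)
     * (f (take j v) (a - a1)%N * g (drop j v) (b - b1)%N))).
  apply: eq_bigr => i _; apply: eq_bigr => j _.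
  transitivity (stuffle_sum (take i u) (take j v) (f^~ a)
                * stuffle_sum (drop i u) (drop j v) (g^~ b)).
    rewrite /stuffle_sum mulr_suml; apply: eq_bigr => z _.
    by rewrite mulr_sumr.
  rewrite hf ?hg ?is_index_take ?is_index_drop // big_distrlr /=.
  by apply: eq_bigr => a1 _; apply: eq_bigr => b1 _; ring.
under [RHS]eq_bigr do under eq_bigr do rewrite big_distrlr /=.
(* Both sides run over cuts and degrees; only the order of summation differs. *)
rewrite pair_big [RHS]pair_big /=.
under eq_bigr do rewrite pair_big /=.
under [RHS]eq_bigr do rewrite pair_big /=.
by rewrite exchange_big.
Qed.

(** * The (s,t)-adic values *)

Lemma lin_ext_hprod_index (V : comUnitRingType) (f : seq nat -> V) k l :
  lin_ext f (hprod_index k l) = stuffle_sum k l f.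
Proof.
rewrite /lin_ext hprod_index_stuffle big_map -stuffle_sum_rev.
by apply: eq_bigr => m _ /=; rewrite (ratr_nat _ 1) mul1r.
Qed.

(** In a general unit ring [ratr] need not be a morphism, so the two signs are treated as
    integers. *)
Lemma ratr_sign (V : comUnitRingType) n : ratr ((-1) ^+ n) = (-1) ^+ n :> V.
Proof.
rewrite -signr_odd -[in RHS]signr_odd; case: (odd n).
  by rewrite !expr1 (ratr_int _ (-1)).
by rewrite !expr0 (ratr_nat _ 1).
Qed.

Section Values.
Variables (R : realType) (Zs : seq nat -> {poly R}).
Hypothesis HZs : is_Zstar Zs.

(** The depth sign in [zeta_star] cancels the signs of the harmonic product of words. *)
Lemma zeta_star_character : is_character (zeta_star Zs).
Proof.
move=> u v hu hv; case: HZs => _ _ _ hZ.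
rewrite /zeta_star mulrACA -hZ // -exprD.
rewrite -[LHS]stuffle_sum_rev /stuffle_sum /lin_ext /hprod_word.
rewrite hprod_rev_stuffle /comb_map !big_map mulr_sumr.
apply: eq_bigr => m _ /=; rewrite ratr_sign mulrA -exprD !size_rev.
by rewrite addnA addnn exprD -[in RHS]signr_odd odd_double mul1r.
Qed.

Lemma shift_coef_shifted sg u j :
  shift_coef Zs sg u j = (sg ^+ j)%:P * shifted (zeta_star Zs) u j.
Proof.
rewrite /shift_coef shifted_tuple mulr_sumr; apply: eq_bigr => n _.
by rewrite mulrC scaler_nat mulr_natl.
Qed.

(** Rescaling the variable by [sg] preserves Cauchy products. *)
Lemma shift_coef_character sg : is_ps_character (shift_coef Zs sg).
Proof.
move=> u v j hu hv.
transitivity ((sg ^+ j)%:P * stuffle_sum u v (shifted (zeta_star Zs) ^~ j)).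
  rewrite /stuffle_sum mulr_sumr; apply: eq_bigr => m _.
  exact: shift_coef_shifted.
rewrite shifted_character //; last exact: zeta_star_character.
rewrite mulr_sumr; apply: eq_bigr => i _; rewrite !shift_coef_shifted.
have -> : sg ^+ j = sg ^+ i * sg ^+ (j - i) by rewrite -exprD subnKC // -ltnS.
by rewrite polyCM mulrACA.
Qed.

Lemma zetaS_coef_stuffle k l a b : is_index k -> is_index l ->
  stuffle_sum k l (fun m => zetaS_coef Zs m a b)
  = ps_mul (zetaS_coef Zs k) (zetaS_coef Zs l) a b.
Proof.
move=> hk hl.
(* [f] carries [s] and [T1]; [g] carries [t] and [T2], with the reversal and the weight sign built
   in. *)
pose f u j : {poly {poly R}} := (shift_coef Zs (-1) u j)%:P.
pose g u j : {poly {poly R}} :=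
  (-1) ^+ sumn u * map_poly polyC (shift_coef Zs 1 (rev u) j).
have hf : is_ps_character f.
  exact: (ps_character_rmorph _ _ polyC) (shift_coef_character _).
have hg : is_ps_character g.
  apply: ps_character_twist.
  apply: (ps_character_rev _ (fun u j => map_poly polyC (shift_coef Zs 1 u j))).
  exact: (ps_character_rmorph _ _ (map_poly polyC)) (shift_coef_character _).
have zetaSE m a' b' : zetaS_coef Zs m a' b' =
    deconc _ (fun x y => f x a' * g y b') m.
  apply: eq_bigr => i _.
  by rewrite /f /g mulrA !rmorphXn !rmorphN1 [(-1) ^+ _ * _]mulrC.
rewrite (eq_stuffle_sum _ _ _ _ _ (fun m => zetaSE m a b)).
rewrite stuffle_deconc_ps_mul //.
by apply: eq_bigr => a1 _; apply: eq_bigr => b1 _; rewrite !zetaSE.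
Qed.

End Values.

Theorem theorem3p2 (R : realType) (Zs : seq nat -> {poly R}) (HZs : is_Zstar Zs)
  (k l : seq nat) (hk : is_index k) (hl : is_index l) :
  (forall a b : nat,
     lin_ext (fun m => zetaS_coef Zs m a b) (hprod_index k l)
     = ps_mul (zetaS_coef Zs k) (zetaS_coef Zs l) a b) /\
  (forall a b i : nat,
     in_zeta2_MZ
       ((lin_ext (fun m => zetaS_coef_TT Zs m a b) (hprod_index k l)
         - ps_mul (zetaS_coef_TT Zs k) (zetaS_coef_TT Zs l) a b)`_i)).
Proof.
split=> a b; first by rewrite lin_ext_hprod_index zetaS_coef_stuffle.
(* The difference is exactly zero, so the cofactor of [zeta(2)] is 0. *)
move=> i; exists 0; split.
  by have := inMZ_rat R 0; rewrite raddf0.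
(* Evaluating the outer variable at ['X] sets [T2 = T1] and respects sums and products. *)
have -> : lin_ext (fun m => zetaS_coef_TT Zs m a b) (hprod_index k l)
    = ps_mul (zetaS_coef_TT Zs k) (zetaS_coef_TT Zs l) a b.
  rewrite lin_ext_hprod_index /stuffle_sum /zetaS_coef_TT -horner_sum.
  rewrite -[X in X.['X]]/(stuffle_sum k l (fun m => zetaS_coef Zs m a b)).
  rewrite zetaS_coef_stuffle // /ps_mul horner_sum; apply: eq_bigr => a1 _.
  by rewrite horner_sum; apply: eq_bigr => b1 _; rewrite hornerM.
by rewrite subrr coef0 mulr0.
Qed.
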